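(* Let $n\ge 1$ and let $|||\cdot|||$ be any unitarily invariant norm on the $n\times n$ complex matrices. For all $n\times n$ complex matrices $X$ and $Y$, and all $q\in[0,1]$, $$|||XY^*|||^2 \le |||qX^*X+(1-q)Y^*Y|||\;\cdot\;|||(1-q)X^*X+qY^*Y|||.$$
   Context: $X^*$ denotes the conjugate transpose of $X$. A norm $|||\cdot|||$ on $n\times n$ complex matrices is unitarily invariant if $|||UAV|||=|||A|||$ for every $n\times n$ matrix $A$ and all $n\times n$ unitary matrices $U,V$. *)

(* Defs.v *)
From HB Require Import structures.
From mathcomp Require Import all_boot all_order all_algebra.
From mathcomp Require Import complex.
From mathcomp Require Import reals.

Set Implicit Arguments.
Unset Strict Implicit.
Unset Printing Implicit Defensive.

Import Order.TTheory GRing.Theory Num.Theory.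
Import ComplexField.Normc.

Local Open Scope ring_scope.
Local Open Scope complex_scope.
Local Open Scope sesquilinear_scope.

(* The library norm on matrices is fixed (the entrywise maximum), so an
   arbitrary norm is given as a function [N].  The norm takes its values in
   the reals [R], whence [normc c : R] for the modulus of [c : R[i]]. *)
Record matrix_norm (R : realType) (n : nat) (N : 'M[R[i]]_n -> R) : Prop :=
  MatrixNorm {
    matrix_norm_ge0 : forall A, 0 <= N A;
    matrix_norm_eq0 : forall A, N A = 0 -> A = 0;
    matrix_normZ : forall (c : R[i]) A, N (c *: A) = normc c * N A;
    matrix_normD : forall A B, N (A + B) <= N A + N B
  }.

Definition unitarily_invariant (R : realType) (n : nat)
    (N : 'M[R[i]]_n -> R) : Prop :=
  forall A U V : 'M[R[i]]_n,
    U \is unitarymx -> V \is unitarymx -> N (U *m A *m V) = N A.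

(* Main.v *)
(** Diagonalise [X Y^*] and [P T^*] by unitaries, where [P^* P = C] and
    [T^* T = D] are the two interpolants on the right-hand side.  The key fact
    is that the singular values of [P T^*] dominate those of [X Y^*]; then
    Cauchy-Schwarz for [N], applied to [P] and [T], concludes.

    For the domination, let [a], [b] be the rows of [X], [Y] where the singular
    value of [X Y^*] is at least 1, with [b] rescaled so that [a b^*] is the
    identity, and rotated so that [b b^*] is diagonal.  For a suitable real
    diagonal [e] the vectors [x = q z a + (1 - q) z e b] and
    [y = (1 - q) z a + q z e b] satisfy [|z|^2 + |z e|^2 <= 2 Re <x, y>] for
    all [z].  Writing [x = w P] and [y = v T] gives
    [|w|^2 + |v|^2 <= 2 Re <w P T^*, v>] on a space of dimension the number of
    rows of [a], so at least that many singular values of [P T^*] are >= 1.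

    Everything is first done for invertible [X] and [Y], with the right-hand
    side linearised as [r N(C) + N(D) / r], which makes it stable under
    shifting [X] and [Y] by small multiples of the identity. *)

Require Import Defs.
From HB Require Import structures.
From mathcomp Require Import all_boot all_order all_algebra.
From mathcomp Require Import complex.
From mathcomp Require Import reals.
From mathcomp Require Import fingroup perm ring lra.

Set Implicit Arguments.
Unset Strict Implicit.
Unset Printing Implicit Defensive.

Import Order.TTheory GRing.Theory Num.Theory.

Local Open Scope ring_scope.
Local Open Scope sesquilinear_scope.

Local Notation "''[' u , v ]" := (dotmx u v) : ring_scope.
Local Notation "''[' u ]" := (dotmx u u) : ring_scope.

(** * Adjoints and the inner product of row vectors *)

Lemma adjmxM (C : numClosedFieldType) m n p (A : 'M[C]_(m, n)) (B : 'M_(n, p)) :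
  (A *m B)^t* = B^t* *m A^t*.
Proof. by rewrite trmx_mul map_mxM. Qed.

Lemma adjmxD (C : numClosedFieldType) m n (A B : 'M[C]_(m, n)) :
  (A + B)^t* = A^t* + B^t*.
Proof. by rewrite linearD /= map_mxD. Qed.

Lemma adjmxZ (C : numClosedFieldType) m n (a : C) (A : 'M[C]_(m, n)) :
  (a *: A)^t* = a^* *: A^t*.
Proof. by rewrite linearZ /= map_mxZ. Qed.

Lemma adjmx1 (C : numClosedFieldType) n : (1%:M : 'M[C]_n)^t* = 1%:M.
Proof. by rewrite trmx1 map_mx1. Qed.

Lemma adj_diag_mx (C : numClosedFieldType) n (d : 'rV[C]_n) :
  (forall i, d 0 i \is Num.real) -> (diag_mx d)^t* = diag_mx d.
Proof.
move=> d_real; rewrite tr_diag_mx map_diag_mx; congr diag_mx.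
by apply/rowP=> i; rewrite mxE /= conj_Creal.
Qed.

Lemma dotmxDl (C : numClosedFieldType) n (u v w : 'rV[C]_n) :
  '[u + v, w] = '[u, w] + '[v, w].
Proof. by rewrite !dotmxE mulmxDl mxE. Qed.

Lemma dotmxDr (C : numClosedFieldType) n (u v w : 'rV[C]_n) :
  '[u, v + w] = '[u, v] + '[u, w].
Proof. by rewrite !dotmxE adjmxD mulmxDr mxE. Qed.

Lemma dotmxZl (C : numClosedFieldType) n (a : C) (u v : 'rV[C]_n) :
  '[a *: u, v] = a * '[u, v].
Proof. by rewrite !dotmxE -scalemxAl mxE. Qed.

Lemma dotmxZr (C : numClosedFieldType) n (a : C) (u v : 'rV[C]_n) :
  '[u, a *: v] = a^* * '[u, v].
Proof. by rewrite !dotmxE adjmxZ -scalemxAr mxE. Qed.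

Lemma dotmx_adjr (C : numClosedFieldType) m n (u : 'rV[C]_m) (v : 'rV_n)
    (A : 'M_(m, n)) :
  '[u, v *m A^t*] = '[u *m A, v].
Proof. by rewrite !dotmxE adjmxM trmxCK mulmxA. Qed.

Lemma dotmx_adjl (C : numClosedFieldType) m n (u : 'rV[C]_m) (v : 'rV_n)
    (A : 'M_(m, n)) :
  '[v *m A^t*, u] = '[v, u *m A].
Proof. by rewrite !dotmxE adjmxM mulmxA. Qed.

Lemma dotmxC (C : numClosedFieldType) n (u v : 'rV[C]_n) : '[u, v]^* = '[v, u].
Proof.
rewrite !dotmxE !mxE rmorph_sum; apply: eq_bigr => i _.
by rewrite !mxE rmorphM /= conjCK mulrC.
Qed.

Lemma dotmx_sum (C : numClosedFieldType) n (u v : 'rV[C]_n) :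
  '[u, v] = \sum_i u 0 i * (v 0 i)^*.
Proof. by rewrite dotmxE mxE; apply: eq_bigr => i _; rewrite !mxE. Qed.

Lemma dotmx_row (C : numClosedFieldType) m n p (A : 'M[C]_(m, p))
    (B : 'M_(n, p)) i j :
  '[row i A, row j B] = (A *m B^t*) i j.
Proof. by rewrite dotmx_sum mxE; apply: eq_bigr => k _; rewrite !mxE. Qed.

Lemma dotmx_ge0 (C : numClosedFieldType) n (u : 'rV[C]_n) : 0 <= '[u].
Proof. exact: dnorm_ge0. Qed.

Lemma dotmx_amgm (C : numClosedFieldType) n (u v : 'rV[C]_n) :
  '[u, v] + '[v, u] <= '[u] + '[v].
Proof.
suff E : '[u] + '[v] - ('[u, v] + '[v, u]) = '[u + (-1) *: v].
  by rewrite -subr_ge0 E dotmx_ge0.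
by rewrite dotmxDl !dotmxDr !dotmxZl !dotmxZr rmorphN rmorph1; ring.
Qed.

Lemma dotmx_eq0 (C : numClosedFieldType) n (u : 'rV[C]_n) :
  ('[u] == 0) = (u == 0).
Proof. exact: dnorm_eq0. Qed.

Lemma dotmx_unitary (C : numClosedFieldType) m n (u v : 'rV[C]_m)
    (Q : 'M_(m, n)) :
  Q \is unitarymx -> '[u *m Q, v *m Q] = '[u, v].
Proof. by move=> QU; rewrite -dotmx_adjr mulmxtVK. Qed.

(** * Spectral and singular value decompositions, and Gram factors *)

Lemma spectral_posdef (C : numClosedFieldType) n (H : 'M[C]_n) :
  H^t* = H -> (forall v : 'rV_n, v != 0 -> 0 < '[v *m H, v]) ->
  exists2 S : 'M_n, S \is unitarymx &
  exists2 d : 'rV_n, (forall i, 0 < d 0 i) & S *m H *m S^t* = diag_mx d.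
Proof.
move=> HH Hpos; have /orthomx_spectralP Heq : H \is normalmx.
  by apply/normalmxP; rewrite HH.
set S := spectralmx H in Heq; set d := spectral_diag H in Heq.
have SU : S \is unitarymx by exact: spectral_unitarymx.
have E : S *m H *m S^t* = diag_mx d.
  rewrite [X in _ *m X *m _]Heq !mulmxA mulmxV ?spectral_unit // mul1mx.
  exact: mulmxtVK.
exists S => //; exists d => // i.
(* Each eigenvalue is the value of the form at a row of [S], hence positive. *)
have -> : d 0 i = '[row i S *m H, row i S].
  by rewrite -row_mul dotmx_row E mxE eqxx.
apply: Hpos; apply/eqP=> /(congr1 (fun v => v *m S^t*)).
rewrite mul0mx -row_mul (unitarymxP SU) => /rowP/(_ i).
by rewrite !mxE eqxx => /eqP; rewrite oner_eq0.
Qed.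

Lemma posdef_gram (C : numClosedFieldType) n (Z : 'M[C]_n) (v : 'rV_n) :
  Z \in unitmx -> v != 0 -> 0 < '[v *m (Z *m Z^t*), v].
Proof.
move=> ZU v0; rewrite mulmxA dotmx_adjl lt_def dotmx_ge0 dotmx_eq0 andbT.
by apply: contra v0 => /eqP E; rewrite -(mulmxK ZU v) E mul0mx.
Qed.

(** Diagonalise [Z Z^*] as [S^* d S] and let [s] be the square root of [d]. Then [V = s^-1 S Z] is
    unitary, since [V V^* = s^-1 d s^-1] is the identity. *)
Lemma svd_unitmx (C : numClosedFieldType) n (Z : 'M[C]_n) :
  Z \in unitmx ->
  exists U V : 'M_n, exists s : 'rV_n,
  [/\ U \is unitarymx, V \is unitarymx, forall i, 0 < s 0 i &
     U *m Z *m V^t* = diag_mx s].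
Proof.
move=> ZU; have [||S SU [d d0 dE]] := spectral_posdef (H := Z *m Z^t*).
- by rewrite adjmxM trmxCK.
- by move=> v; exact: posdef_gram.
pose s : 'rV[C]_n := \row_i sqrtC (d 0 i).
pose r : 'rV[C]_n := \row_i (sqrtC (d 0 i))^-1.
have s0 i : 0 < s 0 i by rewrite mxE sqrtC_gt0.
have rR i : r 0 i \is Num.real by rewrite mxE realV gtr0_real ?sqrtC_gt0.
have drE : diag_mx d *m diag_mx r = diag_mx s.
  rewrite mulmx_diag; congr diag_mx; apply/rowP=> i; rewrite !mxE.
  by rewrite -{1}[d 0 i]sqrtCK expr2 mulfK // sqrtC_eq0 gt_eqF.
have rsE : diag_mx r *m diag_mx s = 1%:M.
  rewrite mulmx_diag -diag_const_mx; congr diag_mx; apply/rowP=> i.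
  by rewrite !mxE mulVf // sqrtC_eq0 gt_eqF.
exists S, (diag_mx r *m S *m Z), s; split=> //.
  apply/unitarymxP; rewrite !adjmxM adj_diag_mx // -rsE -drE -dE.
  by rewrite !mulmxA.
by rewrite !adjmxM adj_diag_mx // -drE -dE !mulmxA.
Qed.

Lemma posdef_factor (C : numClosedFieldType) n (H : 'M[C]_n) :
  H^t* = H -> (forall v : 'rV_n, v != 0 -> 0 < '[v *m H, v]) ->
  exists2 P : 'M_n, P \in unitmx & P^t* *m P = H.
Proof.
move=> HH Hpos; have [S SU [d d0 dE]] := spectral_posdef HH Hpos.
pose s : 'rV[C]_n := \row_i sqrtC (d 0 i).
have sR i : s 0 i \is Num.real by rewrite mxE gtr0_real ?sqrtC_gt0.
have ssE : diag_mx s *m diag_mx s = diag_mx d.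
  rewrite mulmx_diag; congr diag_mx; apply/rowP=> i.
  by rewrite !mxE -expr2 sqrtCK.
exists (diag_mx s *m S).
  rewrite unitmx_mul (unitarymx_unit SU) andbT unitmxE det_diag unitfE.
  by apply/prodf_neq0 => i _; rewrite mxE sqrtC_eq0 gt_eqF.
rewrite adjmxM adj_diag_mx // !mulmxA -(mulmxA _ _ (diag_mx s)) ssE -dE.
rewrite !mulmxA (mulmx1C (unitarymxP SU)) mul1mx -mulmxA.
by rewrite (mulmx1C (unitarymxP SU)) mulmx1.
Qed.

(** * Quadratic forms on row vectors: contraction, counting and coercivity *)

Lemma dotmx_diag (C : numClosedFieldType) n (z d e : 'rV[C]_n) :
  (forall i, e 0 i \is Num.real) ->
  '[z *m diag_mx d, z *m diag_mx e] = \sum_i d 0 i * e 0 i * `|z 0 i| ^+ 2.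
Proof.
move=> eR; rewrite dotmx_sum; apply: eq_bigr => i _.
rewrite !mul_mx_diag !mxE rmorphM /= (conj_Creal (eR i)) normCK.
by rewrite mulrACA (mulrC (z 0 i * _)); congr (_ * _); rewrite mulrC.
Qed.

Lemma adjmx_unit (C : numClosedFieldType) n (A : 'M[C]_n) :
  A \in unitmx -> A^t* \in unitmx.
Proof.
move=> AU; have: A^t* *m (invmx A)^t* = 1%:M.
  by rewrite -adjmxM mulVmx // adjmx1.
by case/mulmx1_unit.
Qed.

(** Write [w = u P^*]. Then ['[w]] equals both [q '[u X^*] + (1 - q) '[u Y^*]] and [q '[p1, u X^*] +
    (1 - q) '[p2, u Y^*]], and AM-GM applied to each inner product gives the bound. *)
Lemma factor_dotmx_le (C : numClosedFieldType) n (X Y P : 'M[C]_n) (q : C)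
    (p1 p2 w : 'rV_n) :
  0 <= q <= 1 -> P \in unitmx ->
  P^t* *m P = q *: (X^t* *m X) + (1 - q) *: (Y^t* *m Y) ->
  w *m P = q *: (p1 *m X) + (1 - q) *: (p2 *m Y) ->
  '[w] <= q * '[p1] + (1 - q) * '[p2].
Proof.
move=> /andP[q0 q1] PU PE wE.
have qR : q^* = q by rewrite conj_Creal ?ger0_real.
have qR' : (1 - q)^* = 1 - q by rewrite rmorphB rmorph1 /= qR.
have [u uE] : exists u, u *m P^t* = w.
  by exists (w *m invmx (P^t*)); rewrite mulmxKV // adjmx_unit.
have wu : '[u *m (P^t* *m P), u] = '[w].
  by rewrite mulmxA uE -dotmx_adjr uE.
rewrite PE mulmxDr -!scalemxAr !mulmxA dotmxDl !dotmxZl in wu.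
rewrite -(dotmx_adjr _ _ X) -(dotmx_adjr _ _ Y) in wu.
have ww : '[w] = '[q *: (p1 *m X) + (1 - q) *: (p2 *m Y), u].
  by rewrite -wE -dotmx_adjr uE.
rewrite dotmxDl !dotmxZl -!dotmx_adjr in ww.
have ww' : '[w] = q * '[u *m X^t*, p1] + (1 - q) * '[u *m Y^t*, p2].
  rewrite -dotmxC ww rmorphD !rmorphM /= qR qR'.
  by congr (_ * _ + _ * _); exact: dotmxC.
have a1 := ler_wpM2l q0 (dotmx_amgm p1 (u *m X^t*)).
have q1' : 0 <= 1 - q by rewrite subr_ge0.
have a2 := ler_wpM2l q1' (dotmx_amgm p2 (u *m Y^t*)).
have H := lerD a1 a2; rewrite -subr_ge0 in H; rewrite -subr_ge0.
(* Of the three copies of ['[w]], the added one is expanded by [wu], the two subtracted ones by [ww]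
   and [ww']. *)
have E : q * '[p1] + (1 - q) * '[p2] - '[w] =
          q * '[p1] + (1 - q) * '[p2] + '[w] - '[w] - '[w] by ring.
apply: le_trans H _; rewrite E {2}ww {2}ww' -wu le_eqVlt; apply/orP; left.
by apply/eqP; ring.
Qed.

Lemma left_kernel_vector (F : fieldType) m n (A : 'M[F]_(m, n)) :
  (n < m)%N -> exists2 z : 'rV_m, z != 0 & z *m A = 0.
Proof.
move=> nm; have /rowV0Pn[z /sub_kermxP zA z0] : kermx A != 0.
  rewrite -mxrank_eq0 mxrank_ker -lt0n subn_gt0.
  exact: leq_ltn_trans (rank_leq_col A) nm.
by exists z.
Qed.

(** If fewer than [k] entries of [t] were at least 1, some nonzero [z] would make [z W] vanish at
    all of them. For this [z] every [g i] is nonnegative, while coercivity bounds their sum by 0; so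
    all vanish, which forces [z W = z V = 0], against the second hypothesis. *)
Lemma card_ge1_of_coercive (C : numClosedFieldType) k n (W V : 'M[C]_(k, n))
    (t : 'rV_n) :
  (forall i, 0 <= t 0 i) ->
  (forall z : 'rV_k, z != 0 -> z *m W = 0 -> z *m V != 0) ->
  (forall z : 'rV_k, '[z *m W] + '[z *m V] <=
     '[z *m W *m diag_mx t, z *m V] + '[z *m V, z *m W *m diag_mx t]) ->
  (k <= #|[pred i | (1 <= t 0 i)%R]|)%N.
Proof.
move=> t0 inj coer; set T := [pred i | _]; rewrite leqNgt; apply/negP => Tk.
have [z zn0 zT] := left_kernel_vector (colsub (@enum_val _ T) W) Tk.
set w := z *m W; set v := z *m V.
have wT i : 1 <= t 0 i -> w 0 i = 0.
  move=> ti; have iT : i \in T by [].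
  move/rowP: zT => /(_ (enum_rank_in iT i)).
  by rewrite mulmx_colsub !mxE enum_rankK_in.
pose g i := `|w 0 i| ^+ 2 + `|v 0 i| ^+ 2 -
  t 0 i * (w 0 i * (v 0 i)^* + v 0 i * (w 0 i)^*).
have gT i : 1 <= t 0 i -> g i = `|v 0 i| ^+ 2.
  by move=> ti; rewrite /g (wT i ti) rmorph0 normr0; ring.
have gN i : t 0 i < 1 -> (1 - t 0 i) * (`|w 0 i| ^+ 2 + `|v 0 i| ^+ 2) <= g i.
  move=> ti; rewrite -subr_ge0.
  have -> : g i - (1 - t 0 i) * (`|w 0 i| ^+ 2 + `|v 0 i| ^+ 2) =
    t 0 i * ((w 0 i - v 0 i) * (w 0 i - v 0 i)^*).
    by rewrite /g !normCK rmorphB /=; ring.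
  by rewrite mulr_ge0 ?mul_conjC_ge0.
(* The order of [C] is partial: the dichotomy rests on both sides being real. *)
have case_t i : 1 <= t 0 i \/ t 0 i < 1.
  by case: (real_leP (ger0_real ler01) (ger0_real (t0 i))) => ti; [left|right].
have nn i : 0 <= `|w 0 i| ^+ 2 + `|v 0 i| ^+ 2 by rewrite addr_ge0 ?exprn_ge0.
have g0 i : 0 <= g i.
  have [ti|ti] := case_t i; first by rewrite gT // exprn_ge0.
  by apply: le_trans (gN i ti); rewrite mulr_ge0 // subr_ge0 ltW.
have sg : \sum_i g i = 0.
  apply/le_anti; rewrite sumr_ge0 // andbT.
  have wtE i : (w *m diag_mx t) 0 i = w 0 i * t 0 i by rewrite mul_mx_diag mxE.
  have := coer z; rewrite -/w -/v -subr_le0; congr (_ <= _).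
  rewrite !dotmx_sum -!big_split -sumrB; apply: eq_bigr => i _ /=.
  rewrite wtE rmorphM /= (conj_Creal (ger0_real (t0 i))).
  by rewrite /g !normCK; ring.
have gi i : g i = 0.
  move/eqP: sg; rewrite psumr_eq0 // => /allP/(_ i).
  by rewrite mem_index_enum => /(_ isT)/eqP.
have wv i : w 0 i = 0 /\ v 0 i = 0.
  have [ti|ti] := case_t i.
    split; first exact: wT.
    by move/eqP: (gi i); rewrite gT // expf_eq0 normr_eq0 => /eqP.
  have := gN i ti; rewrite gi pmulr_rle0 ?subr_gt0 // => le0.
  have /eqP : `|w 0 i| ^+ 2 + `|v 0 i| ^+ 2 = 0.
    by apply/le_anti; rewrite le0 nn.
  rewrite paddr_eq0 ?exprn_ge0 // !expf_eq0 !normr_eq0.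
  by move=> /andP[/eqP ? /eqP ?].
have w0 : w = 0 by apply/rowP=> i; rewrite [RHS]mxE; case: (wv i).
have v0 : v = 0 by apply/rowP=> i; rewrite [RHS]mxE; case: (wv i).
by have := inj z zn0 w0; rewrite -/v v0 eqxx.
Qed.

(* [a] is a root of the equation [1 + e^2 = c^2 (f + e^2 / f) + 2 (1 - c^2) e]
   in [e], whose discriminant becomes a square on writing [f = x^2]. *)
Lemma scalar_identity (F : fieldType) (c x : F) : x != 0 -> x + c != 0 ->
  let a := x * (1 + c * x) / (x + c) in
  1 + a ^+ 2 = c ^+ 2 * (x ^+ 2 + a ^+ 2 / x ^+ 2) + 2 * (1 - c ^+ 2) * a.
Proof. by move=> x0 xc0 a; rewrite /a; field; rewrite x0 xc0. Qed.

(** With [p = 2 q (1 - q)], the right-hand side is [p ('[u] + '[v]) + (1 - p) ('[u, v] + '[v, u])].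
    Here ['[v]] and ['[u, v]] are diagonal in [z], and ['[u]] has a diagonal lower bound; [e] is the
    root from [scalar_identity] with [c^2 = p] and [x = d^(-1/2)] in each coordinate. *)
Lemma biorthogonal_coercive (C : numClosedFieldType) k n (a b : 'M[C]_(k, n))
    (d : 'rV_k) (q : C) :
  0 <= q <= 1 -> (forall i, 0 < d 0 i) ->
  a *m b^t* = 1%:M -> b *m b^t* = diag_mx d ->
  exists2 e : 'rV_k, (forall i, e 0 i \is Num.real) &
  forall z : 'rV_k, let u := z *m a in let v := z *m diag_mx e *m b in
  let x := q *: u + (1 - q) *: v in let y := (1 - q) *: u + q *: v in
  is_true ('[z] + '[z *m diag_mx e] <= '[x, y] + '[y, x]).
Proof.
move=> /andP[q0 q1] d0 abE bbE.
have qR : q^* = q by rewrite conj_Creal ?ger0_real.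
have qR' : (1 - q)^* = 1 - q by rewrite rmorphB rmorph1 /= qR.
have q1' : 0 <= 1 - q by rewrite subr_ge0.
pose p := 2 * (q * (1 - q)); pose c := sqrtC p; pose f i := (sqrtC (d 0 i))^-1.
have p0 : 0 <= p by rewrite !mulr_ge0.
have c0 : 0 <= c by rewrite sqrtC_ge0.
have f0 i : 0 < f i by rewrite invr_gt0 sqrtC_gt0.
pose e : 'rV[C]_k := \row_i (f i * (1 + c * f i) / (f i + c)).
have eR i : e 0 i \is Num.real.
  rewrite mxE ger0_real // divr_ge0 ?mulr_ge0 ?addr_ge0 ?mulr_ge0 //;
  exact: ltW.
pose di : 'rV[C]_k := \row_i (d 0 i)^-1.
have diR i : di 0 i \is Num.real by rewrite mxE realV gtr0_real.
have oneR i : (const_mx 1 : 'rV[C]_k) 0 i \is Num.real by rewrite mxE.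
have z1 (z : 'rV[C]_k) : z *m diag_mx (const_mx 1) = z.
  by rewrite diag_const_mx mulmx1.
exists e => // z u v x y.
have didE : diag_mx di *m diag_mx d = 1%:M.
  rewrite mulmx_diag -diag_const_mx; congr diag_mx; apply/rowP=> i.
  by rewrite !mxE mulVf // gt_eqF.
have uvE (w : 'rV_k) : '[z *m a, w *m b] = '[z, w].
  by rewrite -dotmx_adjl -!mulmxA abE mulmx1.
have vvE (w w' : 'rV_k) : '[w *m b, w' *m b] = '[w *m diag_mx d, w'].
  by rewrite -dotmx_adjl -!mulmxA bbE.
(* The vector [z *m diag_mx di *m b] is the orthogonal projection of [u] onto the row space of [b],
   and the sum is its squared length. *)
have uu : \sum_i (d 0 i)^-1 * `|z 0 i| ^+ 2 <= '[u].
  have := dotmx_amgm u (z *m diag_mx di *m b).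
  rewrite -[X in _ + X <= _]dotmxC /u uvE vvE.
  rewrite -(mulmxA z) didE mulmx1 dotmxC.
  rewrite addrC lerD2r; apply: le_trans.
  rewrite -{3}(z1 z) dotmx_diag //; rewrite le_eqVlt; apply/orP; left.
  by apply/eqP; apply: eq_bigr => i _; rewrite !mxE mulr1.
have uv : '[u, v] = \sum_i e 0 i * `|z 0 i| ^+ 2.
  rewrite uvE -{1}(z1 z) dotmx_diag //.
  by apply: eq_bigr => i _; rewrite mxE mul1r.
have vu : '[v, u] = \sum_i e 0 i * `|z 0 i| ^+ 2.
  rewrite -dotmxC uv rmorph_sum; apply: eq_bigr => i _.
  by rewrite rmorphM /= (conj_Creal (eR i)) conj_Creal // rpredX ?normr_real.
have vv : '[v] = \sum_i e 0 i ^+ 2 * d 0 i * `|z 0 i| ^+ 2.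
  rewrite vvE -mulmxA mulmx_diag dotmx_diag //.
  by apply: eq_bigr => i _; rewrite mxE; ring.
have E : '[x, y] + '[y, x] =
    p * ('[u] + '[v]) + (1 - p) * ('[u, v] + '[v, u]).
  rewrite /x /y !dotmxDl !dotmxDr !dotmxZl !dotmxZr qR qR' /p; ring.
rewrite E uv vu.
(* Only the bound [uu] loses anything: with it in place, both sides agree coordinate by
   coordinate. *)
apply: (@le_trans _ _ (p * (\sum_i (d 0 i)^-1 * `|z 0 i| ^+ 2 + '[v]) +
  (1 - p) * (\sum_i e 0 i * `|z 0 i| ^+ 2 + \sum_i e 0 i * `|z 0 i| ^+ 2))).
  rewrite vv -{1 2}(z1 z) !dotmx_diag // -!big_split !mulr_sumr -!big_split /=.
  rewrite le_eqVlt; apply/orP; left; apply/eqP; apply: eq_bigr => i _.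
  have fE : d 0 i = f i ^- 2 by rewrite -exprVn invrK sqrtCK.
  have cE : p = c ^+ 2 by rewrite sqrtCK.
  have fc0 : f i + c != 0 by rewrite gt_eqF // ltr_wpDr.
  have := scalar_identity (lt0r_neq0 (f0 i)) fc0.
  rewrite !mxE fE cE invrK.
  set al := _ / _ => H.
  transitivity ((1 + al ^+ 2) * `|z 0 i| ^+ 2); first by ring.
  by rewrite H; ring.
by rewrite lerD2r ler_wpM2l // lerD2r.
Qed.

(** * Comparison of singular values through threshold counts *)

Lemma dotmx0l (C : numClosedFieldType) n (u : 'rV[C]_n) : '[0, u] = 0.
Proof. by rewrite dotmxE mul0mx mxE. Qed.

Lemma dotmx_diag_le (C : numClosedFieldType) n (z d : 'rV[C]_n) :
  (forall i, 0 <= d 0 i <= 1) -> '[z *m diag_mx d] <= '[z].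
Proof.
move=> d01; rewrite !dotmx_sum ler_sum // => i _.
have /andP[d0 d1] := d01 i.
rewrite mul_mx_diag mxE -!normCK normrM exprMn ler_piMr ?exprn_ge0 //.
by rewrite ger0_norm // exprn_ile1.
Qed.

(** [E] selects the rows given by [h]; dividing by the selected [s] makes [a = E X] and [b = r E Y]
    biorthogonal, and the unitary [S] makes [b b^*] diagonal without disturbing this. So [G1 = S E]
    preserves length, and since [r <= 1] the vector [p2] is no longer than [z e]. *)
Lemma interpolation_coercive (C : numClosedFieldType) k n (X Y : 'M[C]_n)
    (s : 'rV_n) (q : C) (h : 'I_k -> 'I_n) :
  injective h -> 0 <= q <= 1 -> X *m Y^t* = diag_mx s ->
  (forall i, 1 <= s 0 (h i)) ->
  exists G1 G2 : 'M_(k, n), (forall z : 'rV_k, '[z *m G1] = '[z]) /\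
  forall z : 'rV_k, let p1 := z *m G1 in let p2 := z *m G2 in
  let x := q *: (p1 *m X) + (1 - q) *: (p2 *m Y) in
  let y := (1 - q) *: (p1 *m X) + q *: (p2 *m Y) in
  is_true ('[p1] + '[p2] <= '[x, y] + '[y, x]).
Proof.
move=> h_inj q01 XY s1; pose E : 'M[C]_(k, n) := rowsub h 1%:M.
have EM (A : 'M_n) : E *m A *m E^t* = mxsub h h A.
  have -> : E^t* = colsub h 1%:M.
    by apply/matrixP=> i j; rewrite !mxE eq_sym rmorph_nat.
  by rewrite mulmx_colsub mulmx1 -rowsubE; apply/matrixP=> i j; rewrite !mxE.
have EU : E \is unitarymx.
  apply/unitarymxP; rewrite -{1}[E]mulmx1 EM.
  by apply/matrixP=> i j; rewrite !mxE (inj_eq h_inj).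
pose r : 'rV[C]_k := \row_i (s 0 (h i))^-1.
have s0 i : 0 < s 0 (h i) by apply: lt_le_trans (s1 i).
have rR i : r 0 i \is Num.real by rewrite mxE realV gtr0_real.
have r01 i : 0 <= r 0 i <= 1.
  by rewrite mxE invr_ge0 ltW //= invf_le1.
pose a := E *m X; pose b := diag_mx r *m (E *m Y).
have ab : a *m b^t* = 1%:M.
  rewrite /a /b !adjmxM adj_diag_mx // !mulmxA -(mulmxA E) XY EM.
  apply/matrixP=> i j; rewrite mul_mx_diag !mxE (inj_eq h_inj).
  by case: eqVneq => [->|_]; rewrite ?mulr1n ?mulr0n ?mul0r // mulfV ?gt_eqF.
(* This gives [b] a trivial left kernel, so that [b b^*] is positive definite. *)
have ba : b *m a^t* = 1%:M by rewrite -[b]trmxCK -adjmxM ab adjmx1.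
have [||S SU [d d0 dE]] := spectral_posdef (H := b *m b^t*).
- by rewrite adjmxM trmxCK.
- move=> v v0; rewrite mulmxA dotmx_adjl lt_def dotmx_ge0 dotmx_eq0 andbT.
  by apply: contra v0 => /eqP vb; rewrite -(mulmx1 v) -ba mulmxA vb mul0mx.
have SS : S *m S^t* = 1%:M by exact/unitarymxP.
have [||e eR eP] := biorthogonal_coercive (a := S *m a) (b := S *m b) q01 d0.
- by rewrite adjmxM -mulmxA (mulmxA a) ab mul1mx.
- by rewrite -dE adjmxM -!mulmxA.
exists (S *m E), (diag_mx e *m S *m diag_mx r *m E).
have G1E (z : 'rV_k) : '[z *m (S *m E)] = '[z].
  by rewrite mulmxA !dotmx_unitary.
split=> //.
move=> z p1 p2 x y.
have p1E : p1 *m X = z *m (S *m a) by rewrite /p1 /a !mulmxA.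
have p2E : p2 *m Y = z *m diag_mx e *m (S *m b) by rewrite /p2 /b !mulmxA.
rewrite /x /y p1E p2E; apply: le_trans (eP z).
rewrite G1E /p2 !mulmxA (dotmx_unitary _ _ EU) lerD2l.
apply: le_trans (dotmx_diag_le _ r01) _.
by rewrite dotmx_unitary.
Qed.

(** Two contraction bounds, with the weights [q] and [1 - q] exchanged, add up to ['[z W] + '[z V]
    <= '[p1] + '[p2]], which the coercive inequality continues. Both [z W] and [z V] vanish only at
    [z = 0], because ['[p1] = '[z]]. *)
Lemma card_singular_ge1 (C : numClosedFieldType) n (X Y P T : 'M[C]_n)
    (s t : 'rV_n) (q : C) :
  0 <= q <= 1 -> X *m Y^t* = diag_mx s ->
  P \in unitmx -> T \in unitmx ->
  P^t* *m P = q *: (X^t* *m X) + (1 - q) *: (Y^t* *m Y) ->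
  T^t* *m T = (1 - q) *: (X^t* *m X) + q *: (Y^t* *m Y) ->
  P *m T^t* = diag_mx t -> (forall i, 0 <= t 0 i) ->
  (#|[pred i | (1 <= s 0 i)%R]| <= #|[pred i | (1 <= t 0 i)%R]|)%N.
Proof.
move=> q01 XY PU TU PE TE PT t0.
set A := [pred i | (1 <= s 0 i)%R].
have [||G1 [G2 [G1E GP]]] :=
  interpolation_coercive (h := @enum_val _ A) _ q01 XY.
- exact: enum_val_inj.
- by move=> i; have := enum_valP i; rewrite inE.
pose W := (q *: (G1 *m X) + (1 - q) *: (G2 *m Y)) *m invmx P.
pose V := ((1 - q) *: (G1 *m X) + q *: (G2 *m Y)) *m invmx T.
have WE (z : 'rV_#|A|) :
    z *m W *m P = q *: (z *m G1 *m X) + (1 - q) *: (z *m G2 *m Y).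
  by rewrite /W mulmxA mulmxKV // mulmxDr -!scalemxAr !mulmxA.
have VE (z : 'rV_#|A|) :
    z *m V *m T = (1 - q) *: (z *m G1 *m X) + q *: (z *m G2 *m Y).
  by rewrite /V mulmxA mulmxKV // mulmxDr -!scalemxAr !mulmxA.
have coer (z : 'rV_#|A|) : '[z *m G1] + '[z *m G2] <=
    '[z *m W *m diag_mx t, z *m V] + '[z *m V, z *m W *m diag_mx t].
  apply: le_trans (GP z) _; rewrite -WE -VE -PT.
  by rewrite -(dotmx_adjl _ _ T) -(dotmx_adjr _ _ T) !mulmxA.
apply: (card_ge1_of_coercive (W := W) (V := V)) => // z.
  move=> zn0 zW; apply: contra zn0 => /eqP zV.
  have := coer z; rewrite G1E zW zV mul0mx !dotmx0l addr0 => H.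
  rewrite -dotmx_eq0; apply/eqP/le_anti; rewrite dotmx_ge0 andbT.
  by apply: le_trans H; rewrite lerDl dotmx_ge0.
apply: le_trans (coer z).
have q01' : 0 <= 1 - q <= 1.
  by case/andP: q01 => q0 q1; rewrite subr_ge0 q1 gerBl.
have w1 := factor_dotmx_le q01 PU PE (WE z).
have v1 := factor_dotmx_le (X := X) (Y := Y) (p1 := z *m G1) (p2 := z *m G2)
  (w := z *m V) q01' TU.
rewrite subKr in v1; have {}v1 := v1 TE (VE z).
apply: le_trans (lerD w1 v1) _.
suff -> : q * '[z *m G1] + (1 - q) * '[z *m G2] +
  ((1 - q) * '[z *m G1] + q * '[z *m G2]) = '[z *m G1] + '[z *m G2] by [].
by ring.
Qed.

(** By homogeneity: multiplying all four matrices by [c^(-1/2)] keeps the Gram relations and divides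
    [s] and [t] by [c]. *)
Lemma card_singular_ge (C : numClosedFieldType) n (X Y P T : 'M[C]_n)
    (s t : 'rV_n) (q c : C) :
  0 <= q <= 1 -> X *m Y^t* = diag_mx s ->
  P \in unitmx -> T \in unitmx ->
  P^t* *m P = q *: (X^t* *m X) + (1 - q) *: (Y^t* *m Y) ->
  T^t* *m T = (1 - q) *: (X^t* *m X) + q *: (Y^t* *m Y) ->
  P *m T^t* = diag_mx t -> (forall i, 0 <= t 0 i) -> 0 < c ->
  (#|[pred i | (c <= s 0 i)%R]| <= #|[pred i | (c <= t 0 i)%R]|)%N.
Proof.
move=> q01 XY PU TU PE TE PT t0 c0.
pose g := sqrtC c^-1.
have gR : g^* = g by rewrite conj_Creal // ger0_real // sqrtC_ge0 invr_ge0 ltW.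
have gg : g * g = c^-1 by rewrite -expr2 sqrtCK.
have gn0 : g != 0 by rewrite sqrtC_eq0 invr_eq0 gt_eqF.
have gM (A B : 'M_n) : (g *: A) *m (g *: B) = c^-1 *: (A *m B).
  by rewrite -scalemxAl -scalemxAr scalerA gg.
have cE (r : 'rV_n) i : (c <= r 0 i) = (1 <= (c^-1 *: r) 0 i).
  by rewrite mxE mulrC ler_pdivlMr // mul1r.
rewrite (eq_card (B := [pred i | (1 <= (c^-1 *: s) 0 i)%R])); last first.
  by move=> i; rewrite !inE cE.
rewrite (eq_card (A := [pred i | (c <= t 0 i)%R])
  (B := [pred i | (1 <= (c^-1 *: t) 0 i)%R])); last first.
  by move=> i; rewrite !inE cE.
apply: (@card_singular_ge1 _ _ (g *: X) (g *: Y) (g *: P) (g *: T) _ _ q) => //.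
- by rewrite adjmxZ gR gM XY linearZ.
- by rewrite unitmxZ ?unitfE.
- by rewrite unitmxZ ?unitfE.
- rewrite !adjmxZ gR !gM PE scalerDr !scalerA.
  by rewrite (mulrC q) (mulrC (1 - q)).
- rewrite !adjmxZ gR !gM TE scalerDr !scalerA.
  by rewrite (mulrC q) (mulrC (1 - q)).
- by rewrite adjmxZ gR gM PT linearZ.
- by move=> i; rewrite mxE mulr_ge0 // invr_ge0 ltW.
Qed.

(** * Weighted AM-GM, and Gram factors of the interpolants *)

Lemma dotmx_weighted_amgm (C : numClosedFieldType) n (a : C) (u v : 'rV[C]_n) :
  0 < a -> '[u, v] + '[v, u] <= a * '[u] + a^-1 * '[v].
Proof.
move=> a0; pose g := sqrtC a.
have g0 : 0 < g by rewrite sqrtC_gt0.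
have gR : g^* = g by rewrite conj_Creal ?gtr0_real.
have giR : g^-1^* = g^-1 by rewrite conj_Creal ?realV ?gtr0_real.
have gg : g * g = a by rewrite -expr2 sqrtCK.
have gig : g * g^-1 = 1 by rewrite mulfV ?gt_eqF.
have := dotmx_amgm (g *: u) (g^-1 *: v).
rewrite !dotmxZl !dotmxZr gR giR !mulrA -invfM gg gig (mulrC _ g) gig.
by rewrite !mul1r.
Qed.

Lemma posdef_comb_factor (C : numClosedFieldType) n (X Y : 'M[C]_n) (q : C) :
  X \in unitmx -> Y \in unitmx -> 0 <= q <= 1 ->
  exists2 P : 'M_n, P \in unitmx &
  P^t* *m P = q *: (X^t* *m X) + (1 - q) *: (Y^t* *m Y).
Proof.
move=> XU YU /andP[q0 q1].
have qR : q^* = q by rewrite conj_Creal ?ger0_real.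
have q1' : 0 <= 1 - q by rewrite subr_ge0.
apply: posdef_factor.
  by rewrite adjmxD !adjmxZ rmorphB rmorph1 /= qR !adjmxM !trmxCK.
move=> v v0.
have pos (Z : 'M_n) : Z \in unitmx -> 0 < '[v *m (Z^t* *m Z), v].
  by move=> ZU; rewrite -{2}[Z]trmxCK posdef_gram // adjmx_unit.
rewrite mulmxDr -!scalemxAr dotmxDl !dotmxZl.
(* Strict positivity comes from the term in [Y] when [q = 0], and from the term in [X] otherwise. *)
have [->|qn0] := eqVneq q 0; first by rewrite mul0r add0r subr0 mul1r pos.
apply: ltr_wpDr; first by rewrite mulr_ge0 // ltW // pos.
by rewrite mulr_gt0 ?pos // lt_def qn0.
Qed.

Lemma gram_unitary (C : numClosedFieldType) n (U X : 'M[C]_n) :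
  U \is unitarymx -> (U *m X)^t* *m (U *m X) = X^t* *m X.
Proof.
move=> /unitarymxP/mulmx1C UU.
by rewrite adjmxM -mulmxA (mulmxA _ U) UU mul1mx.
Qed.

Lemma gram_comb_unitary (C : numClosedFieldType) n (U V W X Y P : 'M[C]_n)
    (a b : C) :
  U \is unitarymx -> V \is unitarymx -> W \is unitarymx ->
  P^t* *m P = a *: (X^t* *m X) + b *: (Y^t* *m Y) ->
  (W *m P)^t* *m (W *m P) =
    a *: ((U *m X)^t* *m (U *m X)) + b *: ((V *m Y)^t* *m (V *m Y)).
Proof. by move=> UU VU WU PE; rewrite !gram_unitary. Qed.

(** * Decreasing rearrangement and scalar inequalities *)

Lemma sort_perm (R : realDomainType) n (s : 'I_n -> R) :
  exists p : 'S_n, forall i j : 'I_n, (i <= j)%N -> s (p j) <= s (p i).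
Proof.
pose le := [rel i j : 'I_n | s j <= s i].
have le_total : total le by move=> i j /=; exact: le_total.
have le_tr : transitive le by move=> j i k /= h1 h2; exact: le_trans h2 h1.
pose l := sort le (enum 'I_n).
have : perm_eq l (ord_tuple n) by rewrite perm_sort; exact: perm_refl.
case/tuple_permP=> p lE; exists p => i j ij.
have nthE (k : 'I_n) : nth i l k = p k.
  by rewrite lE -tnth_nth tnth_mktuple tnth_ord_tuple.
have sl : size l = n by rewrite size_sort size_enum_ord.
have le_refl : reflexive le by move=> k /=.
have := sorted_leq_nth le_tr le_refl i (sort_sorted le_total (enum 'I_n)).
by move=> /(_ i j); rewrite !inE sl !ltn_ord !nthE; apply.
Qed.

(** Match the two families by decreasing rank. If [t] fell below [s] at rank [i], counted from 0, at
    most [i] values of [t] would reach the threshold [s (ps i)], but at least [i + 1] values of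
    [s]. *)
Lemma perm_dominated (R : realDomainType) n (s t : 'I_n -> R) :
  (forall c, 0 < c ->
     (#|[pred i | (c <= s i)%R]| <= #|[pred i | (c <= t i)%R]|)%N) ->
  (forall i, 0 < s i) -> exists p : 'S_n, forall i, s i <= t (p i).
Proof.
move=> st s0; have [ps psE] := sort_perm s; have [pt ptE] := sort_perm t.
suff H i : s (ps i) <= t (pt i).
  by exists (ps^-1 * pt)%g => i; rewrite permM -{1}(permKV ps i).
rewrite leNgt; apply/negP => lt; have := st _ (s0 (ps i)).
apply/negP; rewrite -ltnNge.
apply: (@leq_ltn_trans #|[pred k | ((pt^-1)%g k < i)%N]|%N).
  apply: subset_leq_card; apply/subsetP => k; rewrite !inE => sk.
  rewrite ltnNge; apply/negP=> /ptE; rewrite permKV => tk.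
  by have := lt_le_trans lt (le_trans sk tk); rewrite ltxx.
apply: (@leq_trans #|[pred k | ((ps^-1)%g k <= i)%N]|%N); last first.
  apply: subset_leq_card; apply/subsetP => k; rewrite !inE => ki.
  by rewrite -(permKV ps k) psE.
(* In terms of ranks the two sets are [j < i] and [j <= i], and [i] separates them. *)
rewrite -(card_image (@perm_inj _ (pt^-1)%g) [pred k | ((pt^-1)%g k < i)%N]).
rewrite -(card_image (@perm_inj _ (ps^-1)%g) [pred k | ((ps^-1)%g k <= i)%N]).
apply/proper_card/properP; split.
  apply/subsetP => k /imageP[j]; rewrite inE => ji ->; apply/imageP.
  by exists (ps ((pt^-1)%g j)); rewrite ?inE permK // ltnW.
exists i; first by apply/imageP; exists (ps i); rewrite ?inE permK.
by apply/imageP=> -[j]; rewrite inE => ji E; rewrite -E ltnn in ji.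
Qed.

(** The bound is required only for some arbitrarily small [e], since shifts that make a matrix
    singular must be avoided. *)
Lemma le_of_small_error (R : realFieldType) (x y K : R) : 0 <= K ->
  (forall d, 0 < d -> exists2 e, 0 < e < d & x <= y + e * K) -> x <= y.
Proof.
move=> K0 H; rewrite leNgt; apply/negP => yx.
have K1 : 0 < K + 1 by rewrite ltr_wpDl.
have [|e /andP[e0 ed] xe] := H ((x - y) / (K + 1)).
  by rewrite divr_gt0 // subr_gt0.
rewrite ltr_pdivlMr // in ed; nra.
Qed.

(** Primed quantities stand for the shifted matrices; their inequality passes to the unprimed ones
    up to an error linear in [e]. *)
Lemma amgm_error (R : realFieldType) (a b e k l x y z x' y' z' : R) :
  z <= z' + e * k -> a * x' <= a * (x + e * l) -> b * y' <= b * (y + e * l) ->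
  2 * z' <= a * x' + b * y' ->
  2 * z <= a * x + b * y + e * (2 * k + a * l + b * l).
Proof. lra. Qed.

Lemma sqr_le_of_amgm (R : realFieldType) (x y z : R) :
  0 <= x -> 0 <= y -> 0 <= z ->
  (forall a, 0 < a -> 2 * z <= a * x + a^-1 * y) -> z ^+ 2 <= x * y.
Proof.
move=> x0 y0; rewrite le_eqVlt => /orP[/eqP<- _|z0 H].
  by rewrite expr0n mulr_ge0.
move: x0; rewrite le_eqVlt => /orP[/eqP xE|x0].
  have y1 : 0 < y + 1 by rewrite ltr_wpDl.
  (* With [x = 0] this weight gives [2 z <= z y / (y + 1)], impossible for [z > 0]. *)
  have := H ((y + 1) / z); rewrite divr_gt0 // => /(_ isT).
  rewrite -xE mulr0 add0r invfM invrK -mulrA ler_pdivlMl //.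
  nra.
(* This weight turns the first term into [z] and avoids the square root of [y / x]. *)
have := H (z / x); rewrite divr_gt0 // => /(_ isT).
rewrite divfK ?gt_eqF // invfM invrK => h.
have : z <= z^-1 * x * y by lra.
by rewrite -mulrA ler_pdivlMl // expr2.
Qed.

Import ComplexField.Normc.
Local Open Scope complex_scope.
Local Open Scope sesquilinear_scope.

Lemma scale_comb (F : comNzRingType) (V : lmodType F) (r e d : F)
    (u v a b c : V) :
  r *: (u + e *: a + d *: c) + (1 - r) *: (v + e *: b + d *: c) =
  r *: u + (1 - r) *: v + ((r * e) *: a + ((1 - r) * e) *: b + d *: c).
Proof.
have r1 : r + (1 - r) = 1 by rewrite addrC subrK.
rewrite !scalerDr !scalerA addrACA -scalerDl -mulrDl r1 mul1r.
by rewrite [in LHS]addrACA -!addrA.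
Qed.

(** * Shrinking and pinching under a unitarily invariant norm *)

Section UnitarilyInvariantNorm.
Context (R : realType) (n : nat) (N : 'M[R[i]]_n -> R).
Context (hN : matrix_norm N) (hU : unitarily_invariant N).
Local Notation C := R[i].

Lemma matrix_normZ_ge0 (r : R) A : 0 <= r -> N (r%:C *: A) = r * N A.
Proof.
move=> r0; rewrite matrix_normZ //; congr (_ * _).
by rewrite /normc /= expr0n addr0 sqrtr_sqr ger0_norm.
Qed.

Lemma norm_unitary_mull (U A : 'M_n) : U \is unitarymx -> N (U *m A) = N A.
Proof.
have U1 : (1%:M : 'M[C]_n) \is unitarymx.
  by apply/unitarymxP; rewrite adjmx1 mulmx1.
by move=> UU; rewrite -[RHS](hU A UU U1) mulmx1.
Qed.

Definition flip_row (k : 'I_n) : 'rV[C]_n := \row_j (-1) ^+ (j == k).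

Lemma flip_unitary k : diag_mx (flip_row k) \is unitarymx.
Proof.
apply/unitarymxP; rewrite adj_diag_mx => [|i]; last first.
  by rewrite mxE rpredX // rpredN rpred1.
rewrite mulmx_diag -diag_const_mx; congr diag_mx; apply/rowP=> i.
by rewrite !mxE -signr_addb addbb.
Qed.

(* Scaling row [k] of [A] by [r] gives a convex combination of [A] and
   [flip_row k] applied to [A]; pinching is the analogous average. *)
Lemma norm_shrink_coord (k : 'I_n) (r : R) (A : 'M_n) : 0 <= r <= 1 ->
  N (diag_mx (\row_j (if j == k then r%:C else 1)) *m A) <= N A.
Proof.
move=> /andP[r0 r1].
have -> : diag_mx (\row_j (if j == k then r%:C else 1)) *m A =
    ((1 + r) / 2)%:C *: A + ((1 - r) / 2)%:C *: (diag_mx (flip_row k) *m A).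
  have two : (2%:C : C) != 0 by rewrite fmorph_eq0 pnatr_eq0.
  apply/matrixP=> i j; rewrite !mul_diag_mx !mxE.
  rewrite !rmorphM !rmorphD rmorphN !rmorph1 fmorphV /=.
  by case: eqP => _ /=; field.
apply: le_trans (matrix_normD hN _ _) _.
rewrite !matrix_normZ_ge0 ?divr_ge0 ?subr_ge0 ?addr_ge0 //.
rewrite (norm_unitary_mull _ (flip_unitary k)).
by rewrite -mulrDl; lra.
Qed.

(** The coordinates are shrunk one at a time; [D l] has treated those in [l]. *)
Lemma norm_shrink (r : 'I_n -> R) (A : 'M_n) : (forall i, 0 <= r i <= 1) ->
  N (diag_mx (\row_i (r i)%:C) *m A) <= N A.
Proof.
move=> r01; pose D (l : seq 'I_n) : 'M[C]_n :=
  diag_mx (\row_i (if i \in l then (r i)%:C else 1)).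
suff H (l : seq 'I_n) : uniq l -> N (D l *m A) <= N A.
  have := H _ (enum_uniq 'I_n); congr (N (_ *m A) <= _).
  by congr diag_mx; apply/rowP=> i; rewrite !mxE mem_enum.
elim: l => [|k l IH] /=.
  move=> _; rewrite (_ : D [::] = 1%:M) ?mul1mx //.
  by rewrite -diag_const_mx; congr diag_mx; apply/rowP=> i; rewrite !mxE.
move=> /andP[kl ul]; apply: le_trans (IH ul).
apply: le_trans (norm_shrink_coord k (D l *m A) (r01 k)).
suff -> : D (k :: l) = diag_mx (\row_j (if j == k then (r k)%:C else 1)) *m D l.
  by rewrite mulmxA.
rewrite mulmx_diag; congr diag_mx; apply/rowP=> i; rewrite !mxE in_cons.
by case: eqVneq => [->|_] /=; rewrite ?(negPf kl) ?mulr1 ?mul1r.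
Qed.

Lemma norm_diag_le (s t : 'I_n -> R) : (forall i, 0 <= s i <= t i) ->
  N (diag_mx (\row_i (s i)%:C)) <= N (diag_mx (\row_i (t i)%:C)).
Proof.
move=> st; have st0 i : 0 <= t i by case/andP: (st i) => s0; exact: le_trans.
have := norm_shrink (r := fun i => s i / t i) (diag_mx (\row_i (t i)%:C)).
have -> : diag_mx (\row_i (s i / t i)%:C) *m diag_mx (\row_i (t i)%:C) =
    diag_mx (\row_i (s i)%:C).
  rewrite mulmx_diag; congr diag_mx; apply/rowP=> i; rewrite !mxE -rmorphM /=.
  (* Where [t i = 0] also [s i = 0], which agrees with the value 0 of the quotient. *)
  congr (_%:C); have [t0|t0] := eqVneq (t i) 0; last by rewrite divfK.
  by have := st i; rewrite t0 mulr0 => /le_anti.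
apply=> i; have /andP[s0 le_st] := st i; rewrite divr_ge0 //=.
have [->|tn0] := eqVneq (t i) 0; first by rewrite invr0 mulr0.
by rewrite ler_pdivrMr ?mul1r // lt_def tn0 st0.
Qed.

(** [D l] clears the off-diagonal entries in the rows and columns of [l]. Adding [k] to [l] averages
    [D l] with its conjugate by the reflection [flip_row k], which has the same norm. *)
Lemma norm_pinch (M : 'M_n) : N (diag_mx (\row_i M i i)) <= N M.
Proof.
pose D (l : seq 'I_n) : 'M[C]_n :=
  \matrix_(i, j)
    (if (i == j) || ((i \notin l) && (j \notin l)) then M i j else 0).
suff H (l : seq 'I_n) : N (D l) <= N M.
  have := H (enum 'I_n); congr (N _ <= _); apply/matrixP=> i j.
  by rewrite !mxE !mem_enum; case: eqVneq => [->|].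
elim: l => [|k l IH].
  suff -> : D [::] = M by [].
  by apply/matrixP=> i j; rewrite !mxE orbT.
apply: le_trans IH.
have -> : D (k :: l) = (2^-1)%:C *: D l +
    (2^-1)%:C *: (diag_mx (flip_row k) *m D l *m diag_mx (flip_row k)).
  have two : (2%:C : C) != 0 by rewrite fmorph_eq0 pnatr_eq0.
  apply/matrixP=> i j; rewrite mul_mx_diag mul_diag_mx !mxE !in_cons fmorphV /=.
  case: (eqVneq i j) => [->|ij] /=.
    by case: eqP => _ /=; field.
  case: (eqVneq i k) => [ik|_] /=; case: (eqVneq j k) => [jk|_] /=.
  - by rewrite ik jk eqxx in ij.
  - by ring.
  - by rewrite andbF; ring.
  - by field.
apply: le_trans (matrix_normD hN _ _) _.
rewrite !matrix_normZ_ge0 ?invr_ge0 // hU ?flip_unitary //.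
by lra.
Qed.

(** * The linearised inequality for invertible matrices *)

Lemma norm_perm_diag (p : 'S_n) (d : 'I_n -> C) :
  N (diag_mx (\row_i d (p i))) = N (diag_mx (\row_i d i)).
Proof.
have pU (r : 'S_n) : (perm_mx r : 'M[C]_n) \is unitarymx.
  apply/unitarymxP; rewrite tr_perm_mx map_perm_mx -perm_mxM.
  by rewrite mulgV perm_mx1.
rewrite -(hU (diag_mx (\row_i d i)) (pU p) (pU (p^-1)%g)).
congr N; apply/matrixP=> i j; rewrite -row_permE -col_permE !mxE.
by rewrite (inj_eq perm_inj).
Qed.

(** Both products are unitarily equivalent to the diagonal matrix of squared singular values of
    [X]. *)
Lemma norm_gramC (X : 'M_n) : X \in unitmx -> N (X *m X^t*) = N (X^t* *m X).
Proof.
move=> /svd_unitmx[U [V [s [UU VU s0 E]]]].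
have UcU : U^t* \is unitarymx by rewrite trmxC_unitary.
have VcU : V^t* \is unitarymx by rewrite trmxC_unitary.
have sR i : s 0 i \is Num.real by rewrite gtr0_real.
have UV (W : 'M[C]_n) : W \is unitarymx -> W^t* *m W = 1%:M.
  by move=> /unitarymxP/mulmx1C.
have Ec : V *m X^t* *m U^t* = diag_mx s.
  by rewrite -(adj_diag_mx sR) -E !adjmxM trmxCK mulmxA.
have E1 : U *m (X *m X^t*) *m U^t* = diag_mx s *m diag_mx s.
  rewrite -{1}E -Ec !mulmxA -(mulmxA (U *m X) (V^t*) V) (UV _ VU).
  by rewrite mulmx1.
have E2 : V *m (X^t* *m X) *m V^t* = diag_mx s *m diag_mx s.
  rewrite -{1}Ec -E !mulmxA -(mulmxA (V *m X^t*) (U^t*) U) (UV _ UU).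
  by rewrite mulmx1.
by rewrite -(hU (X *m X^t*) UU UcU) E1 -E2 (hU _ VU VcU).
Qed.

(** The diagonal entries of [X Y^*] are inner products of corresponding rows, so weighted AM-GM
    bounds their doubles by the diagonal of [M]. Monotonicity on diagonal matrices, pinching and the
    triangle inequality then give the bound. *)
Lemma norm_diag_amgm (X Y : 'M_n) (s : 'I_n -> R) (a : R) :
  X \in unitmx -> Y \in unitmx -> 0 < a -> (forall i, 0 <= s i) ->
  X *m Y^t* = diag_mx (\row_i (s i)%:C) ->
  2 * N (X *m Y^t*) <= a * N (X^t* *m X) + a^-1 * N (Y^t* *m Y).
Proof.
move=> XU YU a0 s0 XY; have ai0 : 0 < a^-1 by rewrite invr_gt0.
pose M : 'M[C]_n := a%:C *: (X *m X^t*) + a^-1%:C *: (Y *m Y^t*).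
have ME i : M i i = a%:C * '[row i X] + a^-1%:C * '[row i Y].
  by rewrite !dotmx_row mxE [X in X + _]mxE [X in _ + X]mxE.
have aC0 : 0 < a%:C by rewrite ltcR.
have aiC0 : 0 < a^-1%:C by rewrite ltcR.
have M0 i : 0 <= M i i by rewrite ME addr_ge0 // mulr_ge0 ?dotmx_ge0 // ltW.
have XYi i : '[row i X, row i Y] = (s i)%:C.
  by rewrite dotmx_row XY !mxE eqxx.
have YXi i : '[row i Y, row i X] = (s i)%:C.
  by rewrite -dotmxC XYi conj_Creal // ger0_real // ler0c.
pose m i := complex.Re (M i i).
have mE i : (m i)%:C = M i i by rewrite RRe_real // ger0_real.
have sm i : 0 <= 2 * s i <= m i.
  rewrite mulr_ge0 //= -lecR mE ME.
  rewrite fmorphV; apply: le_trans (dotmx_weighted_amgm _ _ aC0).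
  by rewrite XYi YXi -rmorphD mulrDl mul1r.
have -> : 2 * N (X *m Y^t*) = N (diag_mx (\row_i (2 * s i)%:C)).
  rewrite XY -matrix_normZ_ge0 //; congr N; apply/matrixP=> i j.
  by rewrite !mxE rmorphM mulrnAr.
apply: le_trans (norm_diag_le sm) _.
have -> : diag_mx (\row_i (m i)%:C) = diag_mx (\row_i M i i).
  by congr diag_mx; apply/rowP=> i; rewrite mxE mE [RHS]mxE.
apply: le_trans (norm_pinch M) _.
apply: le_trans (matrix_normD hN _ _) _.
rewrite (matrix_normZ_ge0 _ (ltW a0)) (matrix_normZ_ge0 _ (ltW ai0)).
by rewrite (norm_gramC XU) (norm_gramC YU).
Qed.

Lemma interpolation_amgm_unit (X Y : 'M_n) (q a : R) :
  X \in unitmx -> Y \in unitmx -> 0 <= q <= 1 -> 0 < a ->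
  2 * N (X *m Y^t*) <=
    a * N (q%:C *: (X^t* *m X) + (1 - q)%:C *: (Y^t* *m Y)) +
    a^-1 * N ((1 - q)%:C *: (X^t* *m X) + q%:C *: (Y^t* *m Y)).
Proof.
move=> XU YU /andP[q0 q1] a0.
have qE : (1 - q)%:C = 1 - q%:C :> C by rewrite rmorphB rmorph1.
have q01 : 0 <= q%:C <= 1 by rewrite ler0c q0 -(rmorph1 (real_complex R)) lecR.
have q01' : 0 <= 1 - q%:C <= 1.
  by rewrite subr_ge0 gerBl; case/andP: q01 => -> ->.
have [P PU PE] := posdef_comb_factor XU YU q01.
have [T TU TE] := posdef_comb_factor XU YU q01'.
rewrite subKr in TE; rewrite qE -PE -TE.
have mulU (A B : 'M[C]_n) :
    A \in unitmx -> B \in unitmx -> A *m B^t* \in unitmx.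
  by move=> AU BU; rewrite unitmx_mul AU adjmx_unit.
have [U [V [s [UU VU s0 sE]]]] := svd_unitmx (mulU _ _ XU YU).
have [U' [V' [t [UU' VU' t0 tE]]]] := svd_unitmx (mulU _ _ PU TU).
have XYE : (U *m X) *m (V *m Y)^t* = diag_mx s by rewrite adjmxM -sE !mulmxA.
have PTE : (U' *m P) *m (V' *m T)^t* = diag_mx t by rewrite adjmxM -tE !mulmxA.
have PU' : U' *m P \in unitmx by rewrite unitmx_mul unitarymx_unit.
have TU' : V' *m T \in unitmx by rewrite unitmx_mul unitarymx_unit.
have tge0 i : 0 <= t 0 i by exact: ltW.
have card c : 0 < c ->
    (#|[pred i | (c <= s 0 i)%R]| <= #|[pred i | (c <= t 0 i)%R]|)%N.
  apply: (card_singular_ge q01 XYE PU' TU' _ _ PTE tge0).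
    exact: (gram_comb_unitary UU VU UU' PE).
  exact: (gram_comb_unitary UU VU VU' TE).
(* The rearrangement uses a total order, so the positive entries of [s] and [t] are moved to [R]. *)
pose s' i := complex.Re (s 0 i); pose t' i := complex.Re (t 0 i).
have s'E i : (s' i)%:C = s 0 i by rewrite RRe_real // gtr0_real.
have t'E i : (t' i)%:C = t 0 i by rewrite RRe_real // gtr0_real.
have [c c0|i|p pE] := perm_dominated (s := s') (t := t').
- have := card c%:C; rewrite ltcR => /(_ c0).
  congr (_ <= _)%N; apply: eq_card => i; rewrite !inE -?s'E -?t'E lecR //.
- by rewrite -ltcR s'E.
have diagE (r : 'rV[C]_n) (r' : 'I_n -> R) : (forall i, (r' i)%:C = r 0 i) ->
    diag_mx r = diag_mx (\row_i (r' i)%:C).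
  by move=> H; congr diag_mx; apply/rowP=> i; rewrite mxE H.
have -> : N (X *m Y^t*) = N (diag_mx s).
  have VcU : V^t* \is unitarymx by rewrite trmxC_unitary.
  by rewrite -sE (hU _ UU VcU).
have st : N (diag_mx s) <= N (diag_mx t).
  rewrite (diagE _ _ s'E) (diagE _ _ t'E).
  rewrite -(norm_perm_diag p (fun i => (t' i)%:C)).
  apply: norm_diag_le => // i.
  by rewrite pE andbT -ler0c s'E ltW.
apply: (@le_trans _ _ (2 * N (diag_mx t))); first by rewrite ler_wpM2l.
(* Left unitary factors do not change Gram matrices, so [U' P] and [V' T] may replace [P] and [T],
   which makes the product diagonal. *)
rewrite -PTE -(gram_unitary P UU') -(gram_unitary T VU').
apply: (norm_diag_amgm (s := t')) => //.
  by move=> i; rewrite -ler0c t'E.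
by rewrite PTE; exact: diagE.
Qed.

(** * Reduction to invertible matrices by small shifts *)

Lemma shift_unitmx (X Y : 'M[C]_n) (d : R) : 0 < d ->
  exists2 e : R, 0 < e < d &
  (X + e%:C%:M \in unitmx) && (Y + e%:C%:M \in unitmx).
Proof.
(* A shift by [e] is invertible for both matrices once [-e] is not a root of [p]. *)
move=> d0; pose p := char_poly X * char_poly Y.
have p0 : p != 0 by rewrite mulf_neq0 // monic_neq0 // char_poly_monic.
(* Starting at [d / 2] keeps every candidate strictly below [d]; among [size p] distinct candidates
   one is not a root. *)
pose f (k : nat) : C := - (d / k.+2%:R)%:C.
have f_inj : injective f.
  move=> k l /oppr_inj/complexI/(mulfI (lt0r_neq0 d0))/invr_inj.
  by move/eqP; rewrite eqr_nat => /eqP[].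
have [k rk] : exists k, ~~ root p (f k).
  suff /allPn[x /mapP[k _ ->]] :
      ~~ all (root p) [seq f k | k <- iota 0 (size p)].
    by exists k.
  apply/negP=> /(max_poly_roots p0); rewrite map_inj_uniq // iota_uniq.
  by move=> /(_ isT); rewrite size_map size_iota ltnn.
exists (d / k.+2%:R).
  rewrite divr_gt0 //= ltr_pdivrMr ?ltr0n // ltr_pMr // ltr1n //.
have uE (Z : 'M[C]_n) : ~~ root (char_poly Z) (f k) ->
    Z + (d / k.+2%:R)%:C%:M \in unitmx.
  rewrite -eigenvalue_root_char negbK -row_free_unit /eigenspace.
  by rewrite kermx_eq0 /f raddfN opprK.
by move: rk; rewrite rootM negb_or => /andP[/uE -> /uE ->].
Qed.

Lemma interpolation_amgm (X Y : 'M_n) (q a : R) : 0 <= q <= 1 -> 0 < a ->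
  2 * N (X *m Y^t*) <=
    a * N (q%:C *: (X^t* *m X) + (1 - q)%:C *: (Y^t* *m Y)) +
    a^-1 * N ((1 - q)%:C *: (X^t* *m X) + q%:C *: (Y^t* *m Y)).
Proof.
move=> q01 a0; have /andP[q0 q1] := q01.
have ai0 : 0 < a^-1 by rewrite invr_gt0.
have NZ (r : R) A : N (r%:C *: A) = `|r| * N A.
  by rewrite matrix_normZ // /normc /= expr0n addr0 sqrtr_sqr.
have shiftM e (A B : 'M[C]_n) : (A + e%:C%:M) *m (B + e%:C%:M) =
    A *m B + e%:C *: (A + B) + (e ^+ 2)%:C *: 1%:M.
  rewrite mulmxDl !mulmxDr mul_scalar_mx mul_mx_scalar mul_scalar_mx.
  rewrite rmorphXn expr2 -scalerA scale_scalar_mx mulr1 scalerDr -!addrA.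
  by congr (_ + _); rewrite addrCA.
have shiftJ e (A : 'M[C]_n) : (A + e%:C%:M)^t* = A^t* + e%:C%:M.
  rewrite adjmxD tr_scalar_mx map_scalar_mx /=; congr (_ + _%:M).
  by rewrite conj_Creal // complex_real.
(* These are the coefficients of [e] in the shifted products; the coefficient of [e^2] is the
   identity. *)
pose A1 := X + Y^t*; pose A2 := X^t* + X; pose A3 := Y^t* + Y.
pose I1 : 'M[C]_n := 1%:M.
pose K1 := N A1 + N I1.
pose K2 := N A2 + N A3 + N I1.
have NX0 A : 0 <= N A by exact: matrix_norm_ge0.
apply: (@le_of_small_error _ _ _ (2 * K1 + a * K2 + a^-1 * K2)) => [|d d0].
  by rewrite !addr_ge0 ?mulr_ge0 ?addr_ge0 // ltW.
(* The cap at 1 gives [e^2 <= e], so the quadratic terms fit into a linear error. *)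
have [|e /andP[e0 ed] /andP[XU YU]] := shift_unitmx X Y (d := Num.min d 1).
  by rewrite lt_min d0 ltr01.
move: ed; rewrite lt_min => /andP[ed e1]; exists e; first by rewrite e0.
have e2 : e ^+ 2 <= e by rewrite expr2 ger_pMr // ltW.
have low : N (X *m Y^t*) <= N ((X + e%:C%:M) *m (Y + e%:C%:M)^t*) + e * K1.
  have -> : X *m Y^t* = (X + e%:C%:M) *m (Y + e%:C%:M)^t* +
     ((- e)%:C *: A1 + (- e ^+ 2)%:C *: I1).
    by rewrite shiftJ shiftM !rmorphN !scaleNr -opprD -[X in X - _]addrA addrK.
  apply: le_trans (matrix_normD hN _ _) _; rewrite lerD2l.
  apply: le_trans (matrix_normD hN _ _) _; rewrite !NZ mulrDr.
  rewrite !normrN (ger0_norm (ltW e0)) (ger0_norm (exprn_ge0 2 (ltW e0))).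
  rewrite lerD2l.
  by rewrite ler_wpM2r.
have up (r : R) : 0 <= r <= 1 ->
  N (r%:C *: ((X + e%:C%:M)^t* *m (X + e%:C%:M)) +
     (1 - r)%:C *: ((Y + e%:C%:M)^t* *m (Y + e%:C%:M))) <=
  N (r%:C *: (X^t* *m X) + (1 - r)%:C *: (Y^t* *m Y)) + e * K2.
  move=> /andP[r0 r1].
  have -> : r%:C *: ((X + e%:C%:M)^t* *m (X + e%:C%:M)) +
     (1 - r)%:C *: ((Y + e%:C%:M)^t* *m (Y + e%:C%:M)) =
     r%:C *: (X^t* *m X) + (1 - r)%:C *: (Y^t* *m Y) +
     ((r * e)%:C *: A2 + ((1 - r) * e)%:C *: A3 + (e ^+ 2)%:C *: I1).
    by rewrite !shiftJ !shiftM !rmorphM !rmorphB !rmorph1 scale_comb.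
  apply: le_trans (matrix_normD hN _ _) _; rewrite lerD2l.
  apply: le_trans (matrix_normD hN _ _) _; rewrite mulrDr.
  rewrite lerD //; last first.
    by rewrite NZ (ger0_norm (exprn_ge0 2 (ltW e0))) ler_wpM2r.
  apply: le_trans (matrix_normD hN _ _) _; rewrite mulrDr.
  have r1' : 0 <= 1 - r by rewrite subr_ge0.
  rewrite !NZ !normrM (ger0_norm r0) (ger0_norm r1') (ger0_norm (ltW e0)).
  rewrite lerD // ler_wpM2r //.
    by rewrite ger_pMl.
  by rewrite ger_pMl // gerBl.
have main := interpolation_amgm_unit XU YU q01 a0.
have u1 := up _ q01.
have u2 : N ((1 - q)%:C *: ((X + e%:C%:M)^t* *m (X + e%:C%:M)) +
     q%:C *: ((Y + e%:C%:M)^t* *m (Y + e%:C%:M))) <=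
  N ((1 - q)%:C *: (X^t* *m X) + q%:C *: (Y^t* *m Y)) + e * K2.
  by have := up (1 - q); rewrite subKr; apply; rewrite subr_ge0 q1 gerBl.
have {}u1 := ler_wpM2l (ltW a0) u1; have {}u2 := ler_wpM2l (ltW ai0) u2.
exact: (amgm_error low u1 u2 main).
Qed.

End UnitarilyInvariantNorm.

Theorem theorem1 (R : realType) (n : nat) (hn : (1 <= n)%N)
    (N : 'M[R[i]]_n -> R) (hN : matrix_norm N) (hU : unitarily_invariant N)
    (X Y : 'M[R[i]]_n) (q : R) (hq : 0 <= q <= 1) :
  N (X *m Y^t*) ^+ 2 <=
    N (q%:C *: (X^t* *m X) + (1 - q)%:C *: (Y^t* *m Y)) *
    N ((1 - q)%:C *: (X^t* *m X) + q%:C *: (Y^t* *m Y)).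
Proof.
(* Optimising the linearised bound over the weight [a] turns the sum into the product. *)
apply: sqr_le_of_amgm => [|||a a0]; [exact: matrix_norm_ge0.. |].
exact: interpolation_amgm.
Qed.
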